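(* Let $(X,\mathcal{T},E)$ and $(Y,\mathcal{S},E')$ be soft topological spaces and let $f:(X,\mathcal{T},E)\to(Y,\mathcal{S},E')$ be a soft function. The following are equivalent: (1) $f$ is soft $sw$-continuous; (2) for each soft open set $V_{E'}$ over $Y$ with $f^{-1}(V_{E'})\neq\Phi_E$, there exists a non-null soft open set $U_E$ over $X$ such that $U_E\sqsubseteq f^{-1}(V_{E'})$; (3) for each soft closed set $F_{E'}$ over $Y$ with $f^{-1}(F_{E'})\neq X_E$, there exists a proper soft closed set $K_E$ over $X$ (i.e. $K_E\neq X_E$) such that $f^{-1}(F_{E'})\sqsubseteq K_E$; (4) for each soft dense set $D_E$ over $X$, the soft set $f(D_E)$ is soft dense over $f(X)$, i.e. soft dense in the soft subspace $f(X_E)$ of $Y$.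
   Context: A soft set $F_E$ over a set $X$ with parameter set $E$ is a map $F:E\to\mathcal{P}(X)$. The null soft set $\Phi_E$ has all values $\emptyset$; the absolute soft set $X_E$ has all values $X$. Inclusion $\sqsubseteq$, union $\sqcup$, intersection $\sqcap$ and complement ($X_E\setminus F_E$, also written $F_E^c$) are taken parameterwise. A soft topology $\mathcal{T}$ on $X$ is a family of soft sets over $X$ (with parameters $E$) containing $\Phi_E$ and $X_E$ and closed under finite intersections and arbitrary unions; $(X,\mathcal{T},E)$ is a soft topological space, members of $\mathcal{T}$ are soft open and their complements are soft closed. $\mathrm{Int}(F_E)$ is the largest soft open set contained in $F_E$ and $\mathrm{Cl}(F_E)$ the smallest soft closed set containing $F_E$. $D_E$ is soft dense if $\mathrm{Cl}(D_E)=X_E$. For a non-null soft subset $Z_E$ of $X_E$, the soft relative topology on $Z_E$ is $\{G_E\sqcap Z_E: G_E\in\mathcal{T}\}$; it makes $Z_E$ a soft subspace (with $Z_E$ as its absolute soft set), and ''over $Z$'' refers to this subspace. A soft function $f$ from $X$ (parameters $E$) to $Y$ (parameters $E'$) is given by maps $u:X\to Y$ and $p:E\to E'$; $f(F_E)(e')=\bigcup_{e\in p^{-1}(e')}u(F(e))$ for $e'\in E'$, and $f^{-1}(G_{E'})(e)=u^{-1}(G(p(e)))$ for $e\in E$. A soft set $G_E$ is soft $sw$-open (soft somewhat open) if $G_E=\Phi_E$ or $\mathrm{Int}(G_E)\neq\Phi_E$. The soft function $f$ is soft $sw$-continuous if $f^{-1}(V_{E'})$ is soft $sw$-open over $X$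 for each soft open set $V_{E'}$ over $Y$. *)

(* Defs.v *)
From mathcomp Require Import all_boot.
From mathcomp Require Import boolp classical_sets.

Set Implicit Arguments.
Unset Strict Implicit.
Unset Printing Implicit Defensive.

Local Open Scope classical_set_scope.

Definition softset (X E : Type) := E -> set X.

Section SoftSets.
Variables X E : Type.
Implicit Types F G H : softset X E.

Definition soft_null : softset X E := fun=> set0.
Definition soft_abs : softset X E := fun=> setT.
Definition soft_sub F G := forall e, F e `<=` G e.
Definition soft_inter F G : softset X E := fun e => F e `&` G e.
Definition soft_diff F G : softset X E := fun e => F e `\` G e.
Definition soft_bigU (C : set (softset X E)) : softset X E :=
  fun e => \bigcup_(G in C) G e.
Definition soft_bigI (C : set (softset X E)) : softset X E :=
  fun e => \bigcap_(G in C) G e.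

Lemma soft_ext F G : (forall e, F e = G e) -> F = G.
Proof. by move=> FG; apply/funext. Qed.

(* A soft topology whose absolute soft set is A.  A soft topology on X is the
   case A = soft_abs; a soft subspace on Z is the case A = Z.  Closure under
   finite intersections is given by the binary case and A itself (the empty
   intersection). *)
Record softTopologyOn (A : softset X E) := SoftTopologyOn {
  soft_open : set (softset X E);
  soft_open_sub : forall G, soft_open G -> soft_sub G A;
  soft_open_null : soft_open soft_null;
  soft_open_carrier : soft_open A;
  soft_openI : forall F G,
    soft_open F -> soft_open G -> soft_open (soft_inter F G);
  soft_open_bigU : forall C : set (softset X E),
    C `<=` soft_open -> soft_open (soft_bigU C) }.

Definition softTopology := softTopologyOn soft_abs.

Section Topology.
Variables (A : softset X E) (T : softTopologyOn A).

Definition soft_closed F := exists2 G, soft_open T G & F = soft_diff A G.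

Definition soft_int F : softset X E :=
  soft_bigU [set G | soft_open T G /\ soft_sub G F].

Definition soft_cl F : softset X E :=
  soft_bigI [set K | soft_closed K /\ soft_sub F K].

Definition soft_dense D := soft_cl D = A.

Definition soft_sw_open G := G = soft_null \/ soft_int G <> soft_null.

Lemma soft_int_largest F :
  [/\ soft_open T (soft_int F), soft_sub (soft_int F) F &
      forall G, soft_open T G -> soft_sub G F -> soft_sub G (soft_int F)].
Proof.
split.
- by apply: soft_open_bigU => G [].
- by move=> e x [G [_ GF] Gx]; exact: GF.
- by move=> G oG GF e x Gx; exists G.
Qed.

Lemma soft_cl_smallest F : soft_sub F A ->
  [/\ soft_closed (soft_cl F), soft_sub F (soft_cl F) &
      forall K, soft_closed K -> soft_sub F K -> soft_sub (soft_cl F) K].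
Proof.
move=> FA; split.
- exists (soft_bigU
    [set G | soft_open T G /\ soft_sub F (soft_diff A G)]).
    by apply: soft_open_bigU => G [].
  apply: soft_ext => e; apply/seteqP; split=> x /=.
    move=> clx; split.
      have [] // := clx (soft_diff A soft_null).
      split; first by exists soft_null => //; exact: soft_open_null.
      by move=> e' y Fy; split=> //; exact: FA.
    move=> [G [oG FG] Gx].
    have [_] := clx (soft_diff A G) (conj (ex_intro2 _ _ G oG erefl) FG).
    exact.
  move=> [Ax nx] K [[G oG ->] FG]; split=> // Gx; apply: nx.
  by exists G.
- by move=> e x Fx K [_ FK]; exact: FK.
- by move=> K cK FK e x; apply.
Qed.

End Topology.

Section Relative.
Variables (A : softset X E) (T : softTopologyOn A) (Z : softset X E).
Hypothesis ZA : soft_sub Z A.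

Definition soft_relative_open : set (softset X E) :=
  [set H | exists2 G, soft_open T G & H = soft_inter G Z].

Lemma soft_relative_open_sub H : soft_relative_open H -> soft_sub H Z.
Proof. by move=> [G _ ->] e x []. Qed.

Lemma soft_relative_open_null : soft_relative_open soft_null.
Proof.
exists soft_null; first exact: soft_open_null.
by apply: soft_ext => e; rewrite /soft_inter set0I.
Qed.

Lemma soft_relative_open_carrier : soft_relative_open Z.
Proof.
exists A; first exact: soft_open_carrier.
by apply: soft_ext => e; rewrite /soft_inter setIidr//; exact: ZA.
Qed.

Lemma soft_relative_openI F G : soft_relative_open F ->
  soft_relative_open G -> soft_relative_open (soft_inter F G).
Proof.
move=> [F' oF ->] [G' oG ->]; exists (soft_inter F' G').
  exact: soft_openI.
by apply: soft_ext => e; rewrite /soft_inter setIACA setIid.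
Qed.

Lemma soft_relative_open_bigU (C : set (softset X E)) :
  C `<=` soft_relative_open -> soft_relative_open (soft_bigU C).
Proof.
move=> CT.
exists (soft_bigU [set G | soft_open T G /\ C (soft_inter G Z)]).
  by apply: soft_open_bigU => G [].
apply: soft_ext => e; apply/seteqP; split=> x /=.
  move=> [H CH Hx]; have [G oG HG] := CT _ CH.
  move: CH Hx; rewrite HG => CH [Gx Zx].
  by split=> //; exists G.
by move=> [[G [oG CG] Gx] Zx]; exists (soft_inter G Z).
Qed.

Definition soft_relative : softTopologyOn Z :=
  SoftTopologyOn soft_relative_open_sub soft_relative_open_null
    soft_relative_open_carrier soft_relative_openI soft_relative_open_bigU.

End Relative.

Lemma soft_sub_abs F : soft_sub F soft_abs.
Proof. by []. Qed.

Definition soft_subspace (T : softTopology) (Z : softset X E) :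
  softTopologyOn Z := soft_relative T (@soft_sub_abs Z).

End SoftSets.

Arguments soft_null {X E}.
Arguments soft_abs {X E}.

Record softFun (X E Y E' : Type) := SoftFun {
  soft_point : X -> Y;
  soft_param : E -> E' }.

Section SoftFunctions.
Variables (X E Y E' : Type) (f : softFun X E Y E').

Definition soft_image (F : softset X E) : softset Y E' :=
  fun e' => \bigcup_(e in soft_param f @^-1` [set e']) (soft_point f @` F e).

Definition soft_preimage (G : softset Y E') : softset X E :=
  fun e => soft_point f @^-1` G (soft_param f e).

Definition soft_sw_continuous (T : softTopology X E) (S : softTopology Y E') :=
  forall V, soft_open S V -> soft_sw_open T (soft_preimage V).

End SoftFunctions.

(* Main.v *)
Require Import Defs.
From mathcomp Require Import all_boot.
From mathcomp Require Import boolp classical_sets.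

(** The first three conditions are reformulations of one another: the soft
    interior of a soft set is non-null iff the soft set contains a non-null
    soft open set ([soft_int_nonnullP]), and parameterwise complementation,
    which commutes with inverse images, exchanges the condition on soft open
    sets and the condition on soft closed sets.

    The link with density is the usual one: [D] is soft dense iff it meets
    every non-null soft open set ([soft_denseP]).  Moreover, a soft set [V]
    meets [f(D)] iff the inverse image of [V] meets [D] ([soft_meet_image]).
    Hence [f(D)] is soft dense in [f(X)] iff [D] meets every non-null inverse
    image of a soft open set ([soft_dense_imageP]).  If the condition on soft
    closed sets holds and the inverse image of a soft open [V] is non-null but
    misses [D], then [D] lies in the inverse image of the complement of [V],
    so in a proper soft closed set, and [D] is not dense.  Conversely, if [f]
    preserves density and the inverse image of a soft open [V] is non-null
    with null interior, then the complement of that inverse image is soft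
    dense although it misses it, a contradiction. *)

Section SoftSetFacts.
Variables X E : Type.
Implicit Types F G D : softset X E.

(** Two soft sets meet when they share a point at a common parameter. *)
Definition soft_meet F G := exists e x, F e x /\ G e x.

Lemma soft_nonnullP F : F <> soft_null <-> exists e x, F e x.
Proof.
split=> [F0|[e [x Fx]] F0]; last by rewrite F0 in Fx.
apply: contrapT => nF; apply: F0; apply: soft_ext => e.
by apply/seteqP; split=> x // Fx; apply: nF; exists e, x.
Qed.

Lemma soft_neq_absP F : F <> soft_abs <-> exists e x, ~ F e x.
Proof.
split=> [FT|[e [x nFx]] FT]; last by rewrite FT in nFx; apply: nFx.
apply: contrapT => nF; apply: FT; apply: soft_ext => e.
by apply/seteqP; split=> x // _; apply: contrapT => nFx; apply: nF; exists e, x.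
Qed.

Lemma soft_int_nonnullP {A : softset X E} (T : softTopologyOn A) F :
  soft_int T F <> soft_null <->
  exists U, [/\ soft_open T U, U <> soft_null & soft_sub U F].
Proof.
have [oI IF Imax] := soft_int_largest T F.
split=> [I0|[U [oU /soft_nonnullP[e [x Ux]] UF]]]; first by exists (soft_int T F).
by apply/soft_nonnullP; exists e, x; exact: (Imax U).
Qed.

(** The hypothesis that [D] lies in the carrier is needed: the closure of a
    soft set that does not is an intersection over the empty family, that is,
    the whole of [X] at every parameter. *)
Lemma soft_denseP {A : softset X E} (T : softTopologyOn A) D : soft_sub D A ->
  soft_dense T D <->
  forall G, soft_open T G -> G <> soft_null -> soft_meet G D.
Proof.
move=> DA; have [[H oH clH] Dcl clmin] := soft_cl_smallest T DA.
split=> [dD G oG /soft_nonnullP[e [x Gx]]|meetD].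
  apply: contrapT => nGD.
  have : soft_sub (soft_cl T D) (soft_diff A G).
    apply: clmin; first by exists G.
    move=> e' y Dy; split; first exact: DA.
    by move=> Gy; apply: nGD; exists e', y.
  by rewrite dD => /(_ e x (soft_open_sub oG Gx))[].
(* The soft open complement of the closure misses [D], hence is null. *)
rewrite /soft_dense clH; apply: soft_ext => e.
apply/seteqP; split=> x; first by case.
move=> Ax; split=> // Hx.
have /(meetD H oH) [e' [y [Hy /Dcl]]] : H <> soft_null.
  by apply/soft_nonnullP; exists e, x.
by rewrite clH => -[].
Qed.

End SoftSetFacts.

Arguments soft_meet {X E} F G.
Arguments soft_nonnullP {X E F}.
Arguments soft_neq_absP {X E F}.
Arguments soft_int_nonnullP {X E A T F}.
Arguments soft_denseP {X E A T D}.

Section SoftFunctionFacts.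
Variables (X E Y E' : Type) (f : softFun X E Y E').

Lemma soft_meet_image (V : softset Y E') (D : softset X E) :
  soft_meet V (soft_image f D) <-> soft_meet (soft_preimage f V) D.
Proof.
split=> [[e' [y [Vy [e /= pe [x Dx uxy]]]]]|[e [x [Vx Dx]]]].
  by exists e, x; split; rewrite // /soft_preimage /= pe uxy.
by exists (soft_param f e), (soft_point f x); split=> //; exists e => //; exists x.
Qed.

Lemma soft_image_sub (D1 D2 : softset X E) : soft_sub D1 D2 ->
  soft_sub (soft_image f D1) (soft_image f D2).
Proof.
move=> D12 e' y [e pe [x Dx <-]].
by exists e => //; exists x => //; exact: D12.
Qed.

(** Density of [f(D)] in the soft subspace [f(X)], in terms of the soft open
    sets of the whole codomain and of [D] itself. *)
Lemma soft_dense_imageP (S : softTopology Y E') (D : softset X E) :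
  soft_dense (soft_subspace S (soft_image f soft_abs)) (soft_image f D) <->
  forall V, soft_open S V -> soft_preimage f V <> soft_null ->
    soft_meet (soft_preimage f V) D.
Proof.
have fDX : soft_sub (soft_image f D) (soft_image f soft_abs).
  exact: soft_image_sub.
rewrite soft_denseP //; split=> [meetD V oV /soft_nonnullP[e [x Vx]]|meetD].
  apply/soft_meet_image.
  have [|//|e' [y [[Vy _] fDy]]] := meetD (soft_inter V (soft_image f soft_abs)).
  - by exists V.
  - apply/soft_nonnullP; exists (soft_param f e), (soft_point f x).
    by split=> //; exists e => //; exists x.
  - by exists e', y.
move=> _ [V oV ->] /soft_nonnullP[e' [y [Vy fXy]]].
have : soft_meet (soft_preimage f V) soft_abs.
  by apply/soft_meet_image; exists e', y.
move=> [e [x [Vx _]]].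
have /soft_meet_image [e1 [y1 [Vy1 fDy1]]] : soft_meet (soft_preimage f V) D.
  by apply: meetD => //; apply/soft_nonnullP; exists e, x.
by exists e1, y1; split=> //; split=> //; exact: fDX.
Qed.

End SoftFunctionFacts.

Arguments soft_dense_imageP {X E Y E' f S D}.

Theorem theorem4p5 (X E Y E' : Type) (T : softTopology X E)
    (S : softTopology Y E') (f : softFun X E Y E') :
  [<-> soft_sw_continuous f T S;
       forall V : softset Y E', soft_open S V -> soft_preimage f V <> soft_null ->
         exists U : softset X E,
           [/\ soft_open T U, U <> soft_null & soft_sub U (soft_preimage f V)];
       forall F : softset Y E', soft_closed S F -> soft_preimage f F <> soft_abs ->
         exists K : softset X E,
           [/\ soft_closed T K, K <> soft_abs & soft_sub (soft_preimage f F) K];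
       forall D : softset X E, soft_dense T D ->
         soft_dense (soft_subspace S (soft_image f soft_abs)) (soft_image f D)].
Proof.
tfae.
- by move=> cf V /cf [//|/soft_int_nonnullP].
- move=> openf _ [V oV ->] /soft_neq_absP[e [x nVx]].
  have /(openf V oV)[U [oU /soft_nonnullP[e1 [x1 Ux1]] UV]] :
      soft_preimage f V <> soft_null.
    by apply/soft_nonnullP; exists e, x; apply: contrapT => nV; apply: nVx.
  exists (soft_diff soft_abs U); split; first by exists U.
    by apply/soft_neq_absP; exists e1, x1 => -[].
  by move=> e2 x2 [_ nVx2]; split=> // /UV.
- move=> closedf D dD; apply/soft_dense_imageP => V oV /soft_nonnullP[e [x Vx]].
  apply: contrapT => nVD.
  have [||K [[G oG ->] /soft_neq_absP[e1 [x1 nKx1]] VK]] :=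
    closedf (soft_diff soft_abs V); first by exists V.
    by apply/soft_neq_absP; exists e, x => -[].
  have /(proj1 (soft_denseP (@soft_sub_abs _ _ D)) dD G oG)
      [e2 [x2 [Gx2 Dx2]]] : G <> soft_null.
    apply/soft_nonnullP; exists e1, x1.
    by apply: contrapT => nG; apply: nKx1.
  have [|_] := VK e2 x2; last exact.
  by split=> // Vx2; apply: nVD; exists e2, x2.
- move=> densef V oV.
  have [|V0] := pselect (soft_preimage f V = soft_null); [by left|right].
  (* The complement [D] of an inverse image with null interior is dense. *)
  move=> I0; pose D := soft_diff soft_abs (soft_preimage f V).
  have dD : soft_dense T D.
    apply/(soft_denseP (@soft_sub_abs _ _ D)) => G oG G0.
    apply: contrapT => nGD.
    have : soft_int T (soft_preimage f V) <> soft_null; last exact.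
    apply/soft_int_nonnullP; exists G; split=> // e x Gx.
    by apply: contrapT => nVx; apply: nGD; exists e, x.
  have /soft_dense_imageP/(_ V oV V0)[e [x [Vx [_]]]] := densef D dD.
  exact.
Qed.
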